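(* Let $f$ be a Thurston map with exactly four postcritical points, with slope function $\mu_f$ relative to a fixed marking of $(S^2,P_f)$. Let $s=\frac{p}{q}$ be a slope in reduced form, suppose that $\mu_f(s)=s'=\frac{p'}{q'}$, also an extended rational number in reduced form, and let $\rho$ be the multiplier of $s$. If $\frac{p'}{q'}\neq\frac{p}{q}$, then the interval in $\partial\mathbb{H}$ defined by $$|px+q|^2<\rho\,|p'x+q'|^2$$ equals the excluded interval of the half-space theorem for the slope $s$, i.e. the ideal boundary of the hyperbolic half-space $H$ associated to $s$.
   Context: A Thurston map is an orientation-preserving branched covering $f\colon S^2\to S^2$ of degree at least 2 whose postcritical set $P_f$ is finite. Assume $|P_f|=4$. Marking and slopes: let $\Gamma$ be the group of isometries of $\mathbb{R}^2$ of the form $x\mapsto 2\lambda\pm x$, $\lambda\in\mathbb{Z}^2$. A marking of $(S^2,P_f)$ is an identification of $S^2$ with $\mathbb{R}^2/\Gamma$ under which $P_f$ is the image of $\mathbb{Z}^2$. Slopes are elements of $\overline{\mathbb{Q}}=\mathbb{Q}\cup\{\infty\}$, $\infty=1/0$. Call a simple closed curve in $S^2\setminus P_f$ essential if it is neither null homotopic nor peripheral. Every homotopy class of essential simple closed curves contains the image of a line in $\mathbb{R}^2$, whose slope is the slope of the curve; this is a bijection between such classes and $\overline{\mathbb{Q}}$. Slope function and multiplier: for a slope $s$ choose $\gamma$ in $S^2\setminus P_f$ with slope $s$. If no component of $f^{-1}(\gamma)$ is essential, $\mu_f(s)=\odot$ (a symbol not in $\overline{\mathbb{Q}}$). Otherwise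 the essential components $\widetilde\gamma_1,\dots,\widetilde\gamma_k$ of $f^{-1}(\gamma)$ all have the same slope, which is $\mu_f(s)$; the multiplier of $s$ is $\rho=\sum_i d_i^{-1}$, where $d_i$ is the degree with which $f$ maps $\widetilde\gamma_i$ to $\gamma$. $\mathbb{H}$ is the upper half-plane, $\partial\mathbb{H}=\mathbb{R}\cup\{\infty\}$. An inequality $|px+q|^2<c\,|p'x+q'|^2$ at $x=\infty$ is read homogeneously, as $|p|^2<c\,|p'|^2$. The half-space $H$: for a slope $\frac pq$ in reduced form and $m>0$ let $$B_m(\tfrac pq)=\Big\{z\in\mathbb{H}:\frac{\operatorname{Im}(z)}{|pz+q|^2}>m\Big\},$$ a horoball tangent to $\partial\mathbb{H}$ at $-q/p$. Given a slope $s$ with $\mu_f(s)=s'\notin\{s,\odot\}$ and multiplier $\rho$, choose $m>0$ so that the horoballs $B_m(s)$ and $B_{\rho m}(s')$ are tangent to each other. There is a unique hyperbolic geodesic tangent to both horoballs at their point of tangency; it bounds the hyperbolic half-space $H$ that contains $B_m(s)$. The excluded interval of the half-space theorem for $s$ is the ideal boundary of $H$, an open interval in $\partial\mathbb{H}$ containing $-1/s$. *)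

(* Defs.v *)
From HB Require Import structures.
From mathcomp Require Import all_boot all_order all_algebra.
From mathcomp Require Import complex.
From mathcomp Require Import all_classical all_reals all_analysis.
Set Implicit Arguments.
Unset Strict Implicit.
Unset Printing Implicit Defensive.
Import Order.TTheory GRing.Theory Num.Theory.
Import numFieldNormedType.Exports.
Import Normc.
Local Open Scope classical_set_scope.
Local Open Scope complex_scope.
Local Open Scope ring_scope.

(* S^2 is oriented as the Riemann sphere; R[i] gets its usual topology through
   the alias R[i]^o, and [None] is the point at infinity. *)
Definition sphere (R : realType) : Type := one_point_compactification R[i]^o.
HB.instance Definition _ (R : realType) := PointedTopological.on (sphere R).

Definition disk (R : realType) : set R[i]^o := [set z | normc z < 1].
Arguments disk R : clear implicits.

(* The standard complex coordinate at x: w - a at x = a, and 1 / w at infinity.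
   It is an orientation-preserving homeomorphism from the complement of
   [pole x] onto the plane, taking x to 0 (its value at [pole x] is junk). *)
Definition pole (R : realType) (x : sphere R) : sphere R :=
  if x is Some _ then None else Some 0.

Definition coord (R : realType) (x w : sphere R) : R[i] :=
  match x, w with
  | Some a, Some b => (b : R[i]) - a
  | None, Some b => (b : R[i])^-1
  | _, None => 0
  end.

Definition polar (R : realType) (r t : R) : R[i] := (r * cos t) +i* (r * sin t).

(* An embedding g of the disk centered at x preserves orientation when, in the
   coordinate at x, the image of a small positively oriented circle around 0
   winds once in the positive direction around 0; theta is a continuous
   argument along that image. *)
Definition positively_oriented (R : realType) (x : sphere R)
    (g : R[i]^o -> sphere R) : Prop :=
  exists r : R, [/\ 0 < r < 1,
    forall z, normc z <= r -> g z <> pole x &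
    exists theta : R -> R, [/\ continuous theta,
      forall t, theta (t + 2 * pi) = theta t + 2 * pi &
      forall t, let w := coord x (g (polar r t)) in
        w = polar (normc w) (theta t)]].

(* g is the inverse of an orientation-preserving homeomorphism from an open
   neighborhood of x onto the unit disk taking x to 0. *)
Definition disk_chart (R : realType) (x : sphere R)
    (g : R[i]^o -> sphere R) : Prop :=
  [/\ g 0 = x,
      {within disk R, continuous g},
      forall z w, disk R z -> disk R w -> g z = g w -> z = w,
      forall O : set R[i]^o, open O -> O `<=` disk R -> open (g @` O) &
      positively_oriented x g].

(* In suitable orientation-preserving charts at x and f x, the map f is
   z |-> z ^ d. *)
Definition local_degree (R : realType) (f : sphere R -> sphere R)
    (x : sphere R) (d : nat) : Prop :=
  (0 < d)%N /\
  exists g k : R[i]^o -> sphere R, [/\ disk_chart x g, disk_chart (f x) k &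
    forall z, disk R z -> f (g z) = k ((z : R[i]) ^+ d)].

Definition branched_covering (R : realType) (f : sphere R -> sphere R) : Prop :=
  [/\ continuous f, range f = setT &
      forall x, exists d, local_degree f x d].

Definition critical (R : realType) (f : sphere R -> sphere R) :
    set (sphere R) :=
  [set x | exists2 d, (2 <= d)%N & local_degree f x d].

Definition has_degree (R : realType) (f : sphere R -> sphere R) (n : nat) :
    Prop :=
  forall y, ~ (f @` critical f) y -> (f @^-1` [set y] #= `I_n)%card.

Definition postcritical (R : realType) (f : sphere R -> sphere R) :
    set (sphere R) :=
  \bigcup_(n in [set n | (1 <= n)%N]) (iter n f @` critical f).

Definition thurston_map (R : realType) (f : sphere R -> sphere R) : Prop :=
  [/\ branched_covering f,
      exists2 n, (2 <= n)%N & has_degree f n &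
      finite_set (postcritical f)].

(* Closed curves are parametrized by R / Z. *)
Definition closed_curve (R : realType) (c : R -> sphere R) : Prop :=
  continuous c /\ forall t, c (t + 1) = c t.

Definition parametrizes (R : realType) (c : R -> sphere R)
    (gamma : set (sphere R)) : Prop :=
  [/\ closed_curve c,
      forall t u, c t = c u -> exists k : int, t - u = k%:~R &
      range c = gamma].

Definition simple_closed_curve (R : realType) (gamma : set (sphere R)) : Prop :=
  exists c, parametrizes c gamma.

Definition freely_homotopic (R : realType) (X : set (sphere R))
    (c0 c1 : R -> sphere R) : Prop :=
  exists H : R * R -> sphere R, let D := `[0, 1]%classic `*` [set: R] in
    [/\ {within D, continuous H},
        forall s t, D (s, t) -> X (H (s, t)) /\ H (s, t + 1) = H (s, t),
        forall t, H (0, t) = c0 t &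
        forall t, H (1, t) = c1 t].

Definition null_homotopic (R : realType) (X gamma : set (sphere R)) : Prop :=
  exists c x, parametrizes c gamma /\ freely_homotopic X c (fun=> x).

(* Homotopic, in the complement of P, into every neighborhood of some point
   of P. *)
Definition peripheral (R : realType) (P gamma : set (sphere R)) : Prop :=
  exists2 a, P a & forall U, nbhs a U ->
    exists c c', [/\ parametrizes c gamma, closed_curve c',
      range c' `<=` U `\` P & freely_homotopic (~` P) c c'].

Definition essential (R : realType) (P gamma : set (sphere R)) : Prop :=
  [/\ simple_closed_curve gamma, gamma `<=` ~` P,
      ~ null_homotopic (~` P) gamma & ~ peripheral P gamma].

(* Simple closed curves are unoriented: the parametrizations are free. *)
Definition homotopic_curves (R : realType) (X gamma gamma' : set (sphere R)) :
    Prop :=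
  exists c c', [/\ parametrizes c gamma, parametrizes c' gamma' &
    freely_homotopic X c c'].

Definition Gamma_orbit (R : realType) (x y : R * R) : Prop :=
  exists l m : int,
    y = (2 * l%:~R + x.1, 2 * m%:~R + x.2) \/
    y = (2 * l%:~R - x.1, 2 * m%:~R - x.2).

Definition Gamma_rel (R : realType) (x y : R * R) : bool := `[< Gamma_orbit x y >].

Lemma Gamma_rel_refl (R : realType) : reflexive (@Gamma_rel R).
Proof.
by case=> x y; apply/asboolP; exists 0, 0; left; rewrite /= !mulr0 !add0r.
Qed.

Lemma Gamma_orbit_sym (R : realType) (x y : R * R) :
  Gamma_orbit x y -> Gamma_orbit y x.
Proof.
case: x y => [x1 x2] [y1 y2] [l [m [[-> ->]|[-> ->]]]] /=.
  by exists (- l), (- m); left; rewrite /= !mulrNz !mulrN !addKr.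
by exists l, m; right; rewrite /= !subKr.
Qed.

Lemma Gamma_rel_sym (R : realType) : symmetric (@Gamma_rel R).
Proof. by move=> x y; apply/asboolP/asboolP; exact: Gamma_orbit_sym. Qed.

Lemma Gamma_rel_trans (R : realType) : transitive (@Gamma_rel R).
Proof.
move=> [y1 y2] [x1 x2] [z1 z2] /asboolP[l [m /= xy]] /asboolP[k [n /= yz]].
apply/asboolP.
case: xy yz => -[-> ->] [] -[-> ->].
- by exists (k + l), (n + m); left; rewrite /= !intrD !mulrDr !addrA.
- by exists (k - l), (n - m); right; rewrite /= !intrB !mulrBr !opprD !addrA.
- by exists (k + l), (n + m); right; rewrite /= !intrD !mulrDr !addrA.
- exists (k - l), (n - m); left.
  by rewrite /= !intrB !mulrBr !opprB !addrA ![_ - _ + _]addrAC.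
Qed.

Definition Gamma_equiv (R : realType) : equiv_rel (R * R)%type :=
  EquivRel (@Gamma_rel R) (@Gamma_rel_refl R) (@Gamma_rel_sym R)
    (@Gamma_rel_trans R).

Definition pillowcase (R : realType) : Type :=
  quotient_topology {eq_quot (Gamma_equiv R)}%qT.
HB.instance Definition _ (R : realType) := Topological.on (pillowcase R).
HB.instance Definition _ (R : realType) := Quotient.on (pillowcase R).

Definition to_pillowcase (R : realType) : R * R -> pillowcase R :=
  \pi_(pillowcase R)%qT.

Definition homeomorphism (T U : topologicalType) (h : T -> U) : Prop :=
  continuous h /\
  exists g : U -> T, [/\ continuous g, cancel h g & cancel g h].

Definition lattice (R : realType) : set (R * R) :=
  [set x | exists l m : int, x = (l%:~R, m%:~R)].
Arguments lattice R : clear implicits.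

Definition marking (R : realType) (P : set (sphere R))
    (h : pillowcase R -> sphere R) : Prop :=
  homeomorphism h /\ P = (h \o @to_pillowcase R) @` lattice R.

(* Extended rationals; [None] is 1 / 0. *)
Definition slope : Type := option rat.

Definition mk_slope (p q : int) : slope :=
  if q == 0 then None else Some (p%:~R / q%:~R).

Definition line_of_slope (R : realType) (s : slope) (L : set (R * R)) : Prop :=
  exists x : R * R, L =
    if s is Some r then [set (x.1 + t, x.2 + t * ratr r) | t in [set: R]]
    else [set (x.1, x.2 + t) | t in [set: R]].

Definition has_slope (R : realType) (P : set (sphere R))
    (h : pillowcase R -> sphere R) (gamma : set (sphere R)) (s : slope) : Prop :=
  essential P gamma /\
  exists2 L : set (R * R), line_of_slope s L &
    homotopic_curves (~` P) gamma ((h \o @to_pillowcase R) @` L).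

Definition essential_components (R : realType) (f : sphere R -> sphere R)
    (gamma : set (sphere R)) : set (set (sphere R)) :=
  [set C | essential (postcritical f) C /\
    exists2 x, (f @^-1` gamma) x & C = connected_component (f @^-1` gamma) x].

(* [slope_function f h s v] says that mu_f (s) = v, where [v = None] encodes
   the symbol for "no essential component". *)
Definition slope_function (R : realType) (f : sphere R -> sphere R)
    (h : pillowcase R -> sphere R) (s : slope) (v : option slope) : Prop :=
  exists2 gamma, has_slope (postcritical f) h gamma s &
    if v is Some s' then
      essential_components f gamma !=set0 /\
      forall C, essential_components f gamma C ->
        has_slope (postcritical f) h C s'
    else essential_components f gamma = set0.

Definition covering_degree (R : realType) (f : sphere R -> sphere R)
    (C gamma : set (sphere R)) (d : nat) : Prop :=
  forall y, gamma y -> (C `&` f @^-1` [set y] #= `I_d)%card.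

Definition multiplier (R : realType) (f : sphere R -> sphere R)
    (h : pillowcase R -> sphere R) (s : slope) (rho : R) : Prop :=
  exists2 gamma, has_slope (postcritical f) h gamma s &
    let E := essential_components f gamma in
    [/\ finite_set E, E !=set0 &
      exists2 d : set (sphere R) -> nat,
        (forall C, E C -> covering_degree f C gamma (d C)) &
        rho = \sum_(C \in E) ((d C)%:R^-1 : R)].

Definition slope_num (s : slope) : int := if s is Some r then numq r else 1.
Definition slope_den (s : slope) : int := if s is Some r then denq r else 0.

Definition upper_half_plane (R : realType) : set R[i] :=
  [set z | 0 < complex.Im z].
Arguments upper_half_plane R : clear implicits.

Definition horo_height (R : realType) (s : slope) (z : R[i]) : R :=
  complex.Im z / normc ((slope_num s)%:~R * z + (slope_den s)%:~R) ^+ 2.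

Definition horoball (R : realType) (m : R) (s : slope) : set R[i] :=
  upper_half_plane R `&` [set z | m < horo_height s z].

Definition horocycle (R : realType) (m : R) (s : slope) : set R[i] :=
  upper_half_plane R `&` [set z | horo_height s z = m].

(* The geodesics of the upper half-plane are the vertical half-lines (a = 0)
   and the half-circles centered on the real axis (a <> 0); the condition on
   the discriminant says that there are two distinct ideal endpoints.  The
   other half-space is obtained by changing the signs of a, b and c. *)
Definition geodesic_coeffs (R : realType) (a b c : R) : Prop :=
  4 * a * c < b ^+ 2.

Definition geodesic (R : realType) (a b c : R) : set R[i] :=
  upper_half_plane R `&`
  [set z | a * normc z ^+ 2 + b * complex.Re z + c = 0].

Definition half_space (R : realType) (a b c : R) : set R[i] :=
  upper_half_plane R `&`
  [set z | 0 < a * normc z ^+ 2 + b * complex.Re z + c].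

Definition tangent_vector (R : realType) (S : set R[i]) (z v : R[i]) : Prop :=
  exists u : R -> R[i], [/\ u 0 = z,
    \forall t \near (0 : R), S (u t),
    is_derive (0 : R) (1 : R) (fun t => complex.Re (u t)) (complex.Re v) &
    is_derive (0 : R) (1 : R) (fun t => complex.Im (u t)) (complex.Im v)].

Definition tangent_at (R : realType) (S T : set R[i]) (z : R[i]) : Prop :=
  [/\ S z, T z &
      exists2 v, v != 0 & tangent_vector S z v /\ tangent_vector T z v].

(* Tangency with a horoball is tangency with its bounding horocycle. *)
Definition is_excluded_half_space (R : realType) (s s' : slope) (rho : R)
    (H : set R[i]) : Prop :=
  exists m z a b c, [/\ 0 < m,
    tangent_at (horocycle m s) (horocycle (rho * m) s') z,
    [/\ geodesic_coeffs a b c,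
        tangent_at (geodesic a b c) (horocycle m s) z &
        tangent_at (geodesic a b c) (horocycle (rho * m) s') z],
    H = half_space a b c & horoball m s `<=` H].

(* The half-space is unique when s <> s' and 0 < rho; set0 is a dummy default. *)
Definition excluded_half_space (R : realType) (s s' : slope) (rho : R) :
    set R[i] :=
  xget set0 [set H | is_excluded_half_space s s' rho H].

(* Points of the boundary R \cup {infinity} having a neighborhood in the closed
   half-plane (infinity included) all of whose points in the open half-plane
   are in H. *)
Definition ideal_boundary (R : realType) (H : set R[i]) :
    set (one_point_compactification R) :=
  [set x | if x is Some x' then
             exists2 e : R, 0 < e &
               forall z, upper_half_plane R z -> normc (z - x'%:C) < e -> H z
           else
             exists M : R,
               forall z, upper_half_plane R z -> M < normc z -> H z].

Definition excluded_interval (R : realType) (s s' : slope) (rho : R) :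
    set (one_point_compactification R) :=
  ideal_boundary (excluded_half_space s s' rho).

(* |p x + q|^2 < rho |p' x + q'|^2, read homogeneously at infinity. *)
Definition inequality_interval (R : realType) (p q p' q' : int) (rho : R) :
    set (one_point_compactification R) :=
  [set x | if x is Some x' then
             `|p%:~R * (x' : R) + q%:~R| ^+ 2
               < rho * `|p'%:~R * (x' : R) + q'%:~R| ^+ 2
           else `|p%:~R : R| ^+ 2 < rho * `|p'%:~R : R| ^+ 2].

(* Main.v *)
Require Import Defs.
From mathcomp Require Import all_boot all_order all_algebra.
From mathcomp Require Import complex ring lra.
From mathcomp Require Import all_classical all_reals all_analysis.
Import Order.TTheory GRing.Theory Num.Theory.
Import numFieldNormedType.Exports.
Import Normc.

Set Implicit Arguments.
Unset Strict Implicit.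
Unset Printing Implicit Defensive.

Local Open Scope classical_set_scope.
Local Open Scope complex_scope.
Local Open Scope ring_scope.

(** The multiplier [rho] is positive: an essential component contains one of its
points [x], so it meets the fiber over [f x] and covers with positive degree.
Everything else is plane geometry, valid for slopes [s <> s'] and [rho > 0].

Write [N z = |p z + q|^2], [N' z = |p' z + q'|^2] and [D = p q' - p' q], where
[D <> 0].  The horocycles of height [m] for [s] and [rho m] for [s'] are the
curves [m N - y = 0] and [rho m N' - y = 0].  The difference of these two
equations is [m G] with [G = rho N' - N], so at a point of tangency the curve
[G = 0] passes through the point and its gradient is orthogonal to the common
tangent.  The terms [y] cancel in [G], hence [G = 0] is a geodesic; a
geodesic is determined by a point and a direction, so [G = 0] is the geodesic
bounding the half-space, and the inclusion of the horoball for [s], where [N]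
is small against [N'], selects the side [G > 0]
([excluded_half_space_unique]).

Such horoballs do exist ([bisector_half_space_excluded]): on the geodesic from
[- q / p] to [- q' / p'], given by [p z + q = i t (p' z + q')] with [t D > 0],
the point [t^2 = rho] is on both horocycles when [m = 1 / (t D)], and a
polarized discriminant shows that their normals are opposite there.

Finally the ideal boundary of [G > 0] is the set of boundary points where the
real quadratic polynomial [G], or at infinity its leading coefficient, is
positive: a zero of [G] on the boundary is simple because the discriminant is
[4 rho D^2 > 0], so [G] changes sign there.  This is the stated inequality.

All curves here have an equation [a |z|^2 + b x + e y + c = 0].  On such a
curve the squared gradient equals [b^2 + e^2 - 4 a c], so a positive
discriminant makes the curve regular, and tangent vectors are the vectors
orthogonal to the gradient. *)

(** * Positivity of the multiplier *)

Lemma multiplier_gt0 (R : realType) (f : sphere R -> sphere R)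
    (h : pillowcase R -> sphere R) (s : slope) (rho : R) :
  multiplier f h s rho -> 0 < rho.
Proof.
case=> gamma _ [finE [C0 EC0] [d cov_d ->]].
have d_gt0 C : essential_components f gamma C -> (0 < d C)%N.
  move=> EC; rewrite lt0n; apply/negP => /eqP dC0.
  have [_ [x fx defC]] := EC.
  have := cov_d _ EC _ fx; rewrite dC0 II0 card_eq0 => /eqP/seteqP[+ _].
  move/(_ x); apply; split=> //; rewrite defC.
  exact: connected_component_refl.
rewrite (fsbigD1 C0) //=.
have rest_ge0 :
    0 <= \sum_(C \in essential_components f gamma `\ C0) ((d C)%:R^-1 : R).
  by apply: fsumr_ge0 => C _; rewrite invr_ge0.
by rewrite ltr_wpDr// invr_gt0 ltr0n d_gt0.
Qed.

(** * Tangent vectors of circles and lines *)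

Definition circle_form (R : realType) (a b e c : R) (z : R[i]) : R :=
  a * (complex.Re z ^+ 2 + complex.Im z ^+ 2) +
  b * complex.Re z + e * complex.Im z + c.

Definition circle_arc (R : realType) (a b e c : R) : set R[i] :=
  upper_half_plane R `&` [set z | circle_form a b e c z = 0].

(** The differential of [circle_form a b e c] at [z], applied to [v]. *)
Definition circle_dform (R : realType) (a b e : R) (z v : R[i]) : R :=
  (2 * a * complex.Re z + b) * complex.Re v +
  (2 * a * complex.Im z + e) * complex.Im v.

(** Completing squares: [|grad|^2 - disc = 4 a * circle_form]. *)
Lemma circle_gradient_sqr (R : realType) (a b e c : R) (z : R[i]) :
  circle_form a b e c z = 0 ->
  (2 * a * complex.Re z + b) ^+ 2 + (2 * a * complex.Im z + e) ^+ 2 =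
  b ^+ 2 + e ^+ 2 - 4 * a * c.
Proof.
by move=> zC; rewrite -[RHS]addr0 -(mulr0 (4 * a)) -zC /circle_form; ring.
Qed.

Lemma tangent_vector_circle_dform (R : realType) (a b e c : R) (z v : R[i]) :
  tangent_vector (circle_arc a b e c) z v -> circle_dform a b e z v = 0.
Proof.
case=> u [u0 uS].
set X := fun t => complex.Re (u t); set Y := fun t => complex.Im (u t).
move=> dX dY.
pose F := a *: (X * X + Y * Y) + b *: X + e *: Y + cst c.
have dF : is_derive (0 : R) (1 : R) F (circle_dform a b e z v).
  have dXY := is_deriveD (is_deriveM dX dX) (is_deriveM dY dY).
  have := is_deriveD (is_deriveD (is_deriveD (is_deriveZ a dXY)
    (is_deriveZ b dX)) (is_deriveZ e dY))
    (is_derive_cst (c : R^o) (0 : R^o) (1 : R^o)).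
  move/is_derive_eq; apply.
  by rewrite /circle_dform /X /Y u0 /GRing.scale /=; ring.
have : is_derive (0 : R) (1 : R) (cst 0 : R -> R) (circle_dform a b e z v).
  apply: near_eq_is_derive dF; apply: filterS uS => t [_ /= Ft].
  by rewrite -Ft /F /circle_form /X /Y /= /GRing.scale /= !expr2.
by move=> dc; rewrite -(@derive_val _ _ _ _ _ _ _ dc) derive_cst.
Qed.

(** The curve [t |-> z + t v / (1 - i a k t)], where [v = i k n] and [n] is the
gradient at [z], is the image of a real line under a Moebius map; it stays on
the circle because [|v|^2 = k^2 |n|^2]. *)
Lemma circle_dform_tangent_vector (R : realType) (a b e c : R) (z v : R[i]) :
  0 < b ^+ 2 + e ^+ 2 - 4 * a * c -> circle_arc a b e c z ->
  circle_dform a b e z v = 0 -> tangent_vector (circle_arc a b e c) z v.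
Proof.
case: z => x y; case: v => v1 v2.
rewrite /circle_dform /circle_arc /circle_form /upper_half_plane /=.
set n1 := 2 * a * x + b; set n2 := 2 * a * y + e.
move=> disc [/= y0 zC] nv.
have nn0 : n1 ^+ 2 + n2 ^+ 2 != 0.
  by rewrite (@circle_gradient_sqr _ a b e c (x +i* y) zC) gt_eqF.
(* v is k times the normal turned by a right angle *)
pose k := (n1 * v2 - n2 * v1) / (n1 ^+ 2 + n2 ^+ 2).
have v1E : v1 = - k * n2.
  apply: (mulIf nn0); rewrite /k.
  have -> : v1 * (n1 ^+ 2 + n2 ^+ 2) =
      n1 * (n1 * v1 + n2 * v2) - n2 * (n1 * v2 - n2 * v1) by ring.
  by rewrite nv; field.
have v2E : v2 = k * n1.
  apply: (mulIf nn0); rewrite /k.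
  have -> : v2 * (n1 ^+ 2 + n2 ^+ 2) =
      n2 * (n1 * v1 + n2 * v2) + n1 * (n1 * v2 - n2 * v1) by ring.
  by rewrite nv; field.
pose den (t : R) := 1 + (a * k * t) ^+ 2.
have den_neq0 t : den t != 0 by rewrite gt_eqF// ltr_pwDl// sqr_ge0.
pose X (t : R) := x + (t * v1 - a * k * t ^+ 2 * v2) / den t.
pose Y (t : R) := y + (t * v2 + a * k * t ^+ 2 * v1) / den t.
have dden : is_derive (0 : R) (1 : R) den 0.
  rewrite /den; apply: is_derive_eq; rewrite /GRing.scale /=; ring.
have ddenV : is_derive (0 : R) (1 : R) (fun t => (den t)^-1) 0.
  by have := is_deriveV (den_neq0 0) dden; rewrite scaler0.
have dX : is_derive (0 : R) (1 : R) X v1.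
  rewrite /X; apply: is_derive_eq.
  by rewrite /GRing.scale /= /den; field.
have dY : is_derive (0 : R) (1 : R) Y v2.
  rewrite /Y; apply: is_derive_eq.
  by rewrite /GRing.scale /= /den; field.
exists (fun t => X t +i* Y t); split => //=.
- by rewrite /X /Y !mul0r expr0n/= !mulr0 !mul0r !addr0 ?subr0 ?mul0r ?addr0.
- have cY : {for 0, continuous Y}.
    apply: differentiable_continuous; apply/derivable1_diffP.
    exact: (@ex_derive _ _ _ _ _ _ _ dY).
  have : \forall t \near (0 : R), 0 < Y t.
    apply: (cvgr_gt (Y 0) cY).
    by rewrite /Y !mul0r expr0n/= mulr0 !mul0r !addr0 mul0r addr0.
  apply: filterS => t Yt; split => //=.
  rewrite -zC /X /Y v1E v2E /den.
  have -> : b = n1 - 2 * a * x by rewrite /n1; ring.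
  have -> : e = n2 - 2 * a * y by rewrite /n2; ring.
  field; exact: den_neq0.
Qed.

(** In the plane, [f] and [g] are both orthogonal to [u <> 0], hence parallel.
This transfers tangency from the vector that witnesses it for one pair of
curves to the vector that witnesses it for another pair. *)
Lemma orthogonal_trans (R : realFieldType) (f1 f2 g1 g2 u1 u2 v1 v2 : R) :
  f1 ^+ 2 + f2 ^+ 2 != 0 -> (u1, u2) != (0, 0) ->
  f1 * u1 + f2 * u2 = 0 -> g1 * u1 + g2 * u2 = 0 ->
  f1 * v1 + f2 * v2 = 0 -> g1 * v1 + g2 * v2 = 0.
Proof.
move=> f0 u0 fu gu fv.
have u0' : u1 ^+ 2 + u2 ^+ 2 != 0.
  apply: contra u0; rewrite paddr_eq0 ?sqr_ge0// !sqrf_eq0.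
  by move=> /andP[/eqP-> /eqP->].
have fg : f1 * g2 - f2 * g1 = 0.
  apply: (mulfI u0'); rewrite mulr0.
  transitivity ((f1 * u1 + f2 * u2) * (g2 * u1 - g1 * u2) +
    (g1 * u1 + g2 * u2) * (f1 * u2 - f2 * u1)); first by ring.
  by rewrite fu gu !mul0r addr0.
apply: (mulfI f0); rewrite mulr0.
transitivity ((f1 * g1 + f2 * g2) * (f1 * v1 + f2 * v2) +
  (f1 * g2 - f2 * g1) * (f1 * v2 - f2 * v1)); first by ring.
by rewrite fg fv mulr0 mul0r addr0.
Qed.

(** A point and a direction determine a geodesic: tangency to [v] says that
[(a, b)] is orthogonal to [(2 (x v1 + y v2), v1)], which is not zero because
[y] and [v] are not, and then [c] is determined by the point. *)
Lemma tangent_geodesic_unique (R : realType) (a b c a' b' c' : R) (z v : R[i]) :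
  v != 0 -> complex.Im z != 0 ->
  geodesic_coeffs a b c -> geodesic_coeffs a' b' c' ->
  circle_form a b 0 c z = 0 -> circle_form a' b' 0 c' z = 0 ->
  circle_dform a b 0 z v = 0 -> circle_dform a' b' 0 z v = 0 ->
  exists k, [/\ a = k * a', b = k * b' & c = k * c'].
Proof.
case: z v => x y [v1 v2].
rewrite /circle_form /circle_dform /geodesic_coeffs /=.
move=> v0 y0 disc disc' zG zG' dG dG'.
pose r := 2 * (x * v1 + y * v2).
have rv : r ^+ 2 + v1 ^+ 2 != 0.
  apply: contra v0; rewrite paddr_eq0 ?sqr_ge0// !sqrf_eq0 /r.
  move=> /andP[+ /eqP v10]; rewrite v10 mulr0 add0r.
  rewrite !mulf_eq0 (negPf y0) pnatr_eq0 /=.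
  by move=> /eqP ->.
have ab : a * b' - b * a' = 0.
  apply: (mulfI rv); rewrite mulr0.
  transitivity ((a * r + b * v1) * (r * b' - v1 * a') -
    (a' * r + b' * v1) * (r * b - v1 * a)); first by ring.
  have -> : a * r + b * v1 = 0 by rewrite -[RHS]dG /r; ring.
  have -> : a' * r + b' * v1 = 0 by rewrite -[RHS]dG' /r; ring.
  by rewrite !mul0r subr0.
have ab0 : a' ^+ 2 + b' ^+ 2 != 0.
  apply: contraTneq disc' => /eqP; rewrite paddr_eq0 ?sqr_ge0// !sqrf_eq0.
  by move=> /andP[/eqP -> /eqP ->]; rewrite mulr0 mul0r expr0n ltxx.
pose k := (a * a' + b * b') / (a' ^+ 2 + b' ^+ 2).
have ak : a = k * a'.
  apply: (mulIf ab0); rewrite /k mulrAC divfK//.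
  apply: subr0_eq; transitivity (b' * (a * b' - b * a')); first by ring.
  by rewrite ab mulr0.
have bk : b = k * b'.
  apply: (mulIf ab0); rewrite /k mulrAC divfK//.
  apply: subr0_eq; transitivity (- a' * (a * b' - b * a')); first by ring.
  by rewrite ab mulr0.
exists k; split => //.
apply: subr0_eq.
transitivity ((a * (x ^+ 2 + y ^+ 2) + b * x + 0 * y + c) -
  k * (a' * (x ^+ 2 + y ^+ 2) + b' * x + 0 * y + c')).
  by rewrite ak bk; ring.
by rewrite zG zG' mulr0 subr0.
Qed.

(** * Horocycles, horoballs and half-spaces as circles *)

Lemma normc_sqr (R : realType) (z : R[i]) :
  normc z ^+ 2 = complex.Re z ^+ 2 + complex.Im z ^+ 2.
Proof. by case: z => x y /=; rewrite sqr_sqrtr// addr_ge0// sqr_ge0. Qed.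

Lemma normc_ge0 (R : realType) (z : R[i]) : 0 <= normc z.
Proof. by case: z => x y; exact: sqrtr_ge0. Qed.

Definition affine_normsq (R : realType) (p q : R) (z : R[i]) : R :=
  (p * complex.Re z + q) ^+ 2 + (p * complex.Im z) ^+ 2.

Lemma normc_affine_sqr (R : realType) (p q : int) (z : R[i]) :
  normc (p%:~R * z + q%:~R) ^+ 2 = affine_normsq p%:~R q%:~R z.
Proof.
rewrite normc_sqr -!(rmorph_int (@real_complex R)); case: z => x y /=.
by rewrite /affine_normsq /= !mul0r !addr0 subr0.
Qed.

Lemma geodesic_circle_arc (R : realType) (a b c : R) :
  geodesic a b c = circle_arc a b 0 c.
Proof.
by apply/seteqP; split=> z [zH /= zG]; split => //=; move: zG;
  rewrite /circle_form normc_sqr mul0r addr0.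
Qed.

Lemma half_spaceE (R : realType) (a b c : R) : half_space a b c =
  upper_half_plane R `&` [set z | 0 < circle_form a b 0 c z].
Proof.
by apply/seteqP; split=> z [zH /= zG]; split => //=; move: zG;
  rewrite /circle_form normc_sqr mul0r addr0.
Qed.

Lemma horocycle_circle_arc (R : realType) (m : R) (s : slope) :
  let p : R := (slope_num s)%:~R in let q : R := (slope_den s)%:~R in
  0 < m ->
  horocycle m s = circle_arc (m * p ^+ 2) (2 * m * p * q) (-1) (m * q ^+ 2).
Proof.
move=> p q m0.
have formE z : circle_form (m * p ^+ 2) (2 * m * p * q) (-1) (m * q ^+ 2) z =
    m * affine_normsq p q z - complex.Im z.
  by rewrite /circle_form /affine_normsq; ring.
apply/seteqP; split=> z [zH]; rewrite /= /horo_height.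
- rewrite normc_affine_sqr => zE.
  split=> //=; apply/eqP; rewrite formE -zE subr_eq0 divfK//.
  by apply/eqP => N0; move: m0; rewrite -zE N0 invr0 mulr0 ltxx.
- rewrite formE => /eqP; rewrite subr_eq0 => /eqP zE.
  split=> //=; rewrite /horo_height normc_affine_sqr.
  rewrite -zE mulfK//; apply/eqP => N0.
  by move: zH; rewrite /upper_half_plane /= -zE N0 mulr0 ltxx.
Qed.

Lemma affine_normsq_gt0 (R : realType) (p q p' q' : R) (z : R[i]) :
  p * q' - p' * q != 0 -> upper_half_plane R z -> 0 < affine_normsq p q z.
Proof.
move=> D0 z0; rewrite lt0r paddr_eq0 ?sqr_ge0// addr_ge0 ?sqr_ge0// andbT.
apply: contra D0 => /andP[]; rewrite !sqrf_eq0 mulf_eq0 (gt_eqF z0) orbF.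
move=> + /eqP p0; rewrite p0 mul0r add0r => /eqP ->.
by rewrite mul0r mulr0 subr0.
Qed.

Lemma horoballP (R : realType) (m : R) (s s' : slope) (z : R[i]) :
  let p : R := (slope_num s)%:~R in let q : R := (slope_den s)%:~R in
  let p' : R := (slope_num s')%:~R in let q' : R := (slope_den s')%:~R in
  p * q' - p' * q != 0 -> upper_half_plane R z ->
  horoball m s z <-> m * affine_normsq p q z < complex.Im z.
Proof.
move=> p q p' q' D0 z0; have N0 := affine_normsq_gt0 D0 z0.
rewrite -ltr_pdivlMr// /horoball /horo_height -normc_affine_sqr.
by split=> [[]|].
Qed.

(** [D y] is the imaginary part of [(p z + q) conj (p' z + q')], whose modulus
squared is the right-hand side. *)
Lemma affine_normsq_mul_ge (R : realType) (p q p' q' : R) (z : R[i]) :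
  ((p * q' - p' * q) * complex.Im z) ^+ 2 <=
  affine_normsq p q z * affine_normsq p' q' z.
Proof.
rewrite -subr_ge0; set d := (X in 0 <= X).
suff -> : d = ((p * complex.Re z + q) * (p' * complex.Re z + q') +
    p * p' * complex.Im z ^+ 2) ^+ 2 by exact: sqr_ge0.
by rewrite /d /affine_normsq; ring.
Qed.

(** The point [w] with [p w + q = i t (p' w + q')] of the geodesic joining
[- q / p] to [- q' / p']; the horocycle for [p / q] through it has height
[1 / (t D)]. *)
Lemma horoball_axis_point (R : realType) (p q p' q' t : R) :
  let D := p * q' - p' * q in 0 < t * D ->
  exists w : R[i], [/\ 0 < complex.Im w,
    complex.Im w * (t * D) = affine_normsq p q w &
    affine_normsq p q w = t ^+ 2 * affine_normsq p' q' w].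
Proof.
move=> D tD; pose M := p ^+ 2 + t ^+ 2 * p' ^+ 2.
have t0 : t != 0 by apply: contraTneq tD => ->; rewrite mul0r ltxx.
have D0 : D != 0 by apply: contraTneq tD => ->; rewrite mulr0 ltxx.
have M_gt0 : 0 < M.
  have p2 := sqr_ge0 p.
  have tp2 : 0 <= t ^+ 2 * p' ^+ 2 by rewrite mulr_ge0 ?sqr_ge0.
  rewrite lt0r paddr_eq0// addr_ge0// andbT sqrf_eq0.
  rewrite -exprMn sqrf_eq0 mulf_eq0 (negPf t0) /=.
  apply: contra D0 => /andP[/eqP p0 /eqP p'0].
  by rewrite /D p0 p'0 !mul0r subr0.
have M0 : M != 0 by rewrite gt_eqF.
have M1 : p ^+ 2 + (t * p') ^+ 2 != 0 by rewrite exprMn.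
pose w := (- (p * q + t ^+ 2 * p' * q') / M) +i* (t * D / M).
have wN' : affine_normsq p' q' w = D ^+ 2 / M.
  by rewrite /affine_normsq /= /M /D; field.
have wN : affine_normsq p q w = t ^+ 2 * (D ^+ 2 / M).
  by rewrite /affine_normsq /= /M /D; field.
exists w; split => /=; first exact: divr_gt0.
- by rewrite wN; field.
- by rewrite wN wN'.
Qed.

(** * The half-space of the tangent horoballs *)

Lemma exists_small (R : realFieldType) (K1 d1 K2 d2 : R) :
  0 <= K1 -> 0 < d1 -> 0 <= K2 -> 0 < d2 ->
  exists e, [/\ 0 < e, e <= 1, e * K1 < d1 & e * K2 < d2].
Proof.
move=> K10 d10 K20 d20; pose T := 1 + K1 / d1 + K2 / d2.
have k1 : 0 <= K1 / d1 by rewrite divr_ge0// ltW.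
have k2 : 0 <= K2 / d2 by rewrite divr_ge0// ltW.
have T0 : 0 < T by rewrite /T; lra.
exists T^-1; split; first by rewrite invr_gt0.
- by rewrite invf_le1// /T; lra.
- by rewrite mulrC ltr_pdivrMr// mulrC -ltr_pdivrMr// /T; lra.
- by rewrite mulrC ltr_pdivrMr// mulrC -ltr_pdivrMr// /T; lra.
Qed.

Section Bisector.
Variables (R : realType) (s s' : slope) (rho : R).
Let p : R := (slope_num s)%:~R.
Let q : R := (slope_den s)%:~R.
Let p' : R := (slope_num s')%:~R.
Let q' : R := (slope_den s')%:~R.
Let D := p * q' - p' * q.
Hypotheses (rho0 : 0 < rho) (D0 : D != 0).
(* The coefficients of [rho |p' z + q'|^2 - |p z + q|^2]. *)
Let A := rho * p' ^+ 2 - p ^+ 2.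
Let B := 2 * (rho * p' * q' - p * q).
Let C := rho * q' ^+ 2 - q ^+ 2.

Let Dsq : 0 < D ^+ 2.
Proof. by rewrite lt0r sqrf_eq0 D0 sqr_ge0. Qed.

Lemma bisector_coeffs : geodesic_coeffs A B C.
Proof.
rewrite /geodesic_coeffs -subr_gt0.
have -> : B ^+ 2 - 4 * A * C = 4 * rho * D ^+ 2.
  by rewrite /A /B /C /D; ring.
by rewrite pmulr_rgt0// pmulr_rgt0// ltr0n.
Qed.

Lemma bisector_formE z : circle_form A B 0 C z =
  rho * affine_normsq p' q' z - affine_normsq p q z.
Proof. by rewrite /circle_form /affine_normsq /A /B /C; ring. Qed.

(** Only the direction of the common tangent is used, not the value of [m]: the
form [G] is [1 / m] times the difference of the equations of the horocycles, so
it inherits their tangent, and a point of the horoball with [G > 0] fixes the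
sign of the factor between [G] and the given coefficients. *)
Lemma excluded_half_space_unique H :
  is_excluded_half_space s s' rho H -> H = half_space A B C.
Proof.
case=> m [z [a [b [c [m0 tFF' [disc tGF _] HE ball]]]]].
have rm0 : 0 < rho * m by rewrite mulr_gt0.
move: tFF' tGF.
rewrite geodesic_circle_arc !horocycle_circle_arc// -/p -/q -/p' -/q'.
move=> [[z0 zF] [_ zF'] [v v0 [/tangent_vector_circle_dform dF]]].
move=> /tangent_vector_circle_dform dF'.
move=> [[_ zG] _ [u u0 [/tangent_vector_circle_dform dGu]]].
move=> /tangent_vector_circle_dform dFu.
have m_neq0 : m != 0 by rewrite gt_eqF.
have zG0 : circle_form A B 0 C z = 0.
  apply: (mulfI m_neq0).
  rewrite mulr0 -[RHS](subrr 0) -[X in X - _]zF' -[X in _ - X]zF.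
  by rewrite /circle_form /A /B /C; ring.
have dG0 : circle_dform A B 0 z v = 0.
  apply: (mulfI m_neq0).
  rewrite mulr0 -[RHS](subrr 0) -[X in X - _]dF' -[X in _ - X]dF.
  by rewrite /circle_dform /A /B; ring.
have dG : circle_dform a b 0 z v = 0.
  apply: orthogonal_trans dFu dGu dF; last first.
    by move: u0; case: (u) => u1 u2; apply: contra => /eqP[-> ->].
  rewrite (circle_gradient_sqr zF).
  set d := (X in X != 0); have -> : d = 1 by rewrite /d; ring.
  exact: oner_neq0.
have [|k [ak bk ck]] :=
    tangent_geodesic_unique v0 _ disc bisector_coeffs zG zG0 dG dG0.
  by rewrite gt_eqF.
suff k0 : 0 < k.
  rewrite HE !half_spaceE; apply/seteqP.
  split=> w [w0 /= wH]; split=> //=; move: wH;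
  have -> : circle_form a b 0 c w = k * circle_form A B 0 C w by
    rewrite ak bk ck /circle_form; ring.
  - by rewrite pmulr_rgt0.
  - by move=> ?; rewrite mulr_gt0.
have [||||t [t0 t1 tm tr]] :=
    @exists_small _ (D ^+ 2 * m) 1 (D ^+ 2) rho => //.
- by rewrite mulr_ge0// ltW.
- exact: ltW.
have tD : D * t * D = t * D ^+ 2 by ring.
(* a point of the axis close to the ideal point of the horoball *)
have [|w [w0 wF wF']] := @horoball_axis_point _ p q p' q' (D * t).
  by rewrite -/D tD mulr_gt0.
have wN' : 0 < affine_normsq p' q' w.
  by apply: (@affine_normsq_gt0 _ _ _ p q) => //; rewrite -opprB oppr_eq0.
have : H w.
  apply: ball; apply/(horoballP _ D0) => //.
  by rewrite -/p -/q -wF mulrCA gtr_pMr// -/D tD mulrC -mulrA.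
rewrite HE half_spaceE => -[_ /=].
have -> : circle_form a b 0 c w = k * circle_form A B 0 C w.
  by rewrite ak bk ck /circle_form; ring.
rewrite bisector_formE wF' -mulrBl pmulr_lgt0// mulr_gt0// subr_gt0.
by apply: le_lt_trans tr; rewrite exprMn mulrC ler_pM2r// expr2 ler_piMl// ltW.
Qed.

(** If [rho N' <= N], then [rho D^2 y^2 <= rho N N' <= N^2], which is the
inequality [y <= m N] for this [m]. *)
Lemma horoball_sub_bisector m : 0 < m -> m ^+ 2 * (rho * D ^+ 2) = 1 ->
  horoball m s `<=` half_space A B C.
Proof.
move=> m0 mD z zB; have [z0 _] := zB; move/(horoballP _ D0) : zB => /(_ z0).
rewrite -/p -/q => mN.
rewrite half_spaceE; split=> //=; rewrite bisector_formE subr_gt0 ltNge.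
apply/negP => rN.
have N0 := affine_normsq_gt0 D0 z0.
have cs := affine_normsq_mul_ge p q p' q' z.
have mN2 : (m * affine_normsq p q z) ^+ 2 < complex.Im z ^+ 2.
  by rewrite ltr_pXn2r// nnegrE ltW// mulr_gt0.
move: mN2; apply/negP; rewrite -leNgt.
rewrite -[X in X <= _]mul1r -mD exprMn -mulrA ler_pM2l ?exprn_gt0//.
rewrite -mulrA -exprMn -/D.
apply: (@le_trans _ _ (rho * (affine_normsq p q z * affine_normsq p' q' z))).
  by rewrite ler_pM2l.
by rewrite mulrCA expr2 ler_pM2l.
Qed.

(** The horocycles touch where the axis meets [G = 0], that is at the parameter
[t = +- sqrt rho]; the sign of [t] is that of [D]. *)
Lemma bisector_half_space_excluded :
  is_excluded_half_space s s' rho (half_space A B C).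
Proof.
pose t := Num.sqrt rho * Num.sg D.
have tt : t ^+ 2 = rho by rewrite exprMn sqr_sg D0 mulr1 sqr_sqrtr// ltW.
have tD : 0 < t * D.
  by rewrite /t -mulrA -normrEsg mulr_gt0// ?sqrtr_gt0// normr_gt0.
have [w [w0 wN wNN']] := horoball_axis_point tD.
rewrite tt -/p in wNN'; rewrite -/D in wN.
pose m := (t * D)^-1.
have tD0 : t * D != 0 by rewrite gt_eqF.
have m0 : 0 < m by rewrite invr_gt0.
have m_neq0 : m != 0 by rewrite gt_eqF.
have rm0 : 0 < rho * m by rewrite mulr_gt0.
have mD : m ^+ 2 * (rho * D ^+ 2) = 1.
  by rewrite -tt -exprMn -exprMn /m mulVf ?expr1n.
pose n1 := 2 * (rho * m * p' ^+ 2) * complex.Re w + 2 * (rho * m) * p' * q'.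
pose n2 := 2 * (rho * m * p' ^+ 2) * complex.Im w + -1.
pose f1 := 2 * (m * p ^+ 2) * complex.Re w + 2 * m * p * q.
pose f2 := 2 * (m * p ^+ 2) * complex.Im w + -1.
have wF : circle_form (m * p ^+ 2) (2 * m * p * q) (-1) (m * q ^+ 2) w = 0.
  transitivity (m * affine_normsq p q w - complex.Im w).
    by rewrite /circle_form /affine_normsq; ring.
  by rewrite -wN mulrCA /m mulVf// mulr1 subrr.
have wF' :
  circle_form (rho * m * p' ^+ 2) (2 * (rho * m) * p' * q') (-1)
    (rho * m * q' ^+ 2) w = 0.
  transitivity (m * (rho * affine_normsq p' q' w) - complex.Im w).
    by rewrite /circle_form /affine_normsq; ring.
  by rewrite -wNN' -wN mulrCA /m mulVf// mulr1 subrr.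
have wG : circle_form A B 0 C w = 0 by rewrite bisector_formE wNN' subrr.
have nn : n1 ^+ 2 + n2 ^+ 2 = 1.
  by rewrite /n1 /n2 (circle_gradient_sqr wF'); ring.
have ff : f1 ^+ 2 + f2 ^+ 2 = 1.
  by rewrite /f1 /f2 (circle_gradient_sqr wF); ring.
(* the gradients are unit vectors with scalar product -1, hence opposite;
   the scalar product is the polar form of the discriminant *)
have fn : f1 * n1 + f2 * n2 = -1.
  transitivity (1 - 2 * (m ^+ 2 * (rho * D ^+ 2))
    + 2 * (rho * m * p' ^+ 2) *
      circle_form (m * p ^+ 2) (2 * m * p * q) (-1) (m * q ^+ 2) w
    + 2 * (m * p ^+ 2) *
      circle_form (rho * m * p' ^+ 2) (2 * (rho * m) * p' * q') (-1)
        (rho * m * q' ^+ 2) w).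
    by rewrite /f1 /f2 /n1 /n2 /circle_form /D; ring.
  by rewrite mD wF wF'; ring.
have fxn : f1 * n2 - f2 * n1 = 0.
  apply/eqP; rewrite -sqrf_eq0; apply/eqP.
  transitivity ((f1 ^+ 2 + f2 ^+ 2) * (n1 ^+ 2 + n2 ^+ 2) -
    (f1 * n1 + f2 * n2) ^+ 2); first by ring.
  by rewrite ff nn fn; ring.
pose v := (- n2) +i* n1.
have v0 : v != 0.
  apply/eqP => -[/eqP]; rewrite oppr_eq0 => /eqP n20 n10.
  by move: nn; rewrite n10 n20 !expr0n addr0 => /esym/eqP; rewrite oner_eq0.
have dF : circle_dform (m * p ^+ 2) (2 * m * p * q) (-1) w v = 0.
  transitivity (- (f1 * n2 - f2 * n1)); last by rewrite fxn oppr0.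
  by rewrite /circle_dform /= -/f1 -/f2; ring.
have dF' :
    circle_dform (rho * m * p' ^+ 2) (2 * (rho * m) * p' * q') (-1) w v = 0.
  by rewrite /circle_dform /= -/n1 -/n2; ring.
have dG : circle_dform A B 0 w v = 0.
  apply: (mulfI m_neq0).
  rewrite mulr0 -[RHS](subrr 0) -[X in X - _]dF' -[X in _ - X]dF.
  by rewrite /circle_dform /A /B; ring.
have tF := circle_dform_tangent_vector _ (conj w0 wF) dF.
have tF' := circle_dform_tangent_vector _ (conj w0 wF') dF'.
have tG := circle_dform_tangent_vector _ (conj w0 wG) dG.
have {}tF : tangent_vector (horocycle m s) w v.
  rewrite horocycle_circle_arc//; apply: tF.
  set d := (X in 0 < X); have -> : d = 1 by rewrite /d; ring.
  exact: ltr01.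
have {}tF' : tangent_vector (horocycle (rho * m) s') w v.
  rewrite horocycle_circle_arc//; apply: tF'.
  set d := (X in 0 < X); have -> : d = 1 by rewrite /d; ring.
  exact: ltr01.
have {}tG : tangent_vector (geodesic A B C) w v.
  rewrite geodesic_circle_arc; apply: tG.
  by rewrite expr0n/= addr0 subr_gt0; exact: bisector_coeffs.
have hF : horocycle m s w by rewrite horocycle_circle_arc.
have hF' : horocycle (rho * m) s' w by rewrite horocycle_circle_arc.
have hG : geodesic A B C w by rewrite geodesic_circle_arc.
exists m, w, A, B, C; split => //.
- by split=> //; exists v.
- by split; [exact: bisector_coeffs | |]; split=> //; exists v.
exact: horoball_sub_bisector.
Qed.

Lemma excluded_half_spaceE : excluded_half_space s s' rho = half_space A B C.
Proof.
rewrite /excluded_half_space; case: xgetP => [H _ /= |/(_ (half_space A B C))].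
  exact: excluded_half_space_unique.
by move/(_ bisector_half_space_excluded).
Qed.

End Bisector.

(** * Ideal boundaries of half-spaces *)

(** With [g] the value and [n] the derivative at [x], the form is
[g + n h + a (h^2 + y^2)] at [x + h + i y].  So it keeps the sign of [g > 0]
near [x]; if [g <= 0], then it takes values [<= 0] near [x], by [n^2 > 0] when
[g = 0]. *)
Lemma ideal_boundary_half_space_real (R : realType) (a b c x : R) :
  geodesic_coeffs a b c ->
  ideal_boundary (half_space a b c) (Some x) <-> 0 < a * x ^+ 2 + b * x + c.
Proof.
rewrite /geodesic_coeffs => disc; set g := a * x ^+ 2 + b * x + c.
set n := 2 * a * x + b.
have nE : n ^+ 2 = (b ^+ 2 - 4 * a * c) + 4 * a * g by rewrite /n /g; ring.
have formE z : circle_form a b 0 c z = g + n * (complex.Re z - x) +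
    a * ((complex.Re z - x) ^+ 2 + complex.Im z ^+ 2).
  by rewrite /circle_form /g /n; ring.
have distE z :
    normc (z - x%:C) ^+ 2 = (complex.Re z - x) ^+ 2 + complex.Im z ^+ 2.
  by case: z => u v; rewrite normc_sqr /= subr0.
rewrite half_spaceE; split=> [[e e0 eH]|g0].
- rewrite ltNge; apply/negP => g_le0.
  (* g = 0 forces n <> 0: move from x against n, by t n, and up, by t *)
  have d0 : 0 < n ^+ 2 - g.
    move: g_le0; rewrite le_eqVlt => /predU1P[g0|g0].
      by rewrite nE g0; lra.
    by rewrite subr_gt0 (lt_le_trans g0)// sqr_ge0.
  have n2 := sqr_ge0 n.
  have [||||t [t0 t1 tK te]] :=
    @exists_small _ (`|a| * (n ^+ 2 + 1)) (n ^+ 2 - g) (n ^+ 2 + 1) e => //.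
  - by rewrite mulr_ge0// addr_ge0.
  - by rewrite addr_ge0.
  have := eH ((x - t * n) +i* t) t0.
  have te2 : normc (((x - t * n) +i* t) - x%:C) < e.
    rewrite -(ltr_pXn2r (ltn0Sn 1)) ?nnegrE ?normc_ge0 ?(ltW e0)// distE /=.
    apply: (@le_lt_trans _ _ ((t * (n ^+ 2 + 1)) ^+ 2)).
      have -> : (x - t * n - x) ^+ 2 + t ^+ 2 = t ^+ 2 * (n ^+ 2 + 1) by ring.
      rewrite exprMn ler_pM2l ?exprn_gt0// expr2 ler_peMl//; lra.
    by rewrite ltr_pXn2r ?nnegrE ?(ltW e0)// mulr_ge0 ?(ltW t0)//; lra.
  move=> /(_ te2)[_ /=]; rewrite formE /=; apply/negP; rewrite -leNgt.
  have -> : g + n * (x - t * n - x) + a * ((x - t * n - x) ^+ 2 + t ^+ 2) =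
     g - t * n ^+ 2 + t * (t * (a * (n ^+ 2 + 1))) by ring.
  have h1 : t * (t * (a * (n ^+ 2 + 1))) <= t * (n ^+ 2 - g).
    rewrite ler_pM2l// (le_trans _ (ltW tK))// ler_pM2l//.
    by rewrite ler_wpM2r ?ler_norm//; lra.
  have h2 : (1 - t) * g <= 0 by rewrite mulr_ge0_le0// subr_ge0.
  lra.
- have [||||e [e0 e1 eK _]] := @exists_small _ (`|n| + `|a|) g 0 1 => //.
  exists e => // z z0 ze; split=> //=; rewrite formE.
  set d := complex.Re z - x; set r := d ^+ 2 + complex.Im z ^+ 2.
  have re : r <= e ^+ 2.
    by rewrite /r /d -distE ler_pXn2r ?nnegrE ?normc_ge0 ?(ltW e0)// ltW.
  have r0 : 0 <= r by rewrite addr_ge0 ?sqr_ge0.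
  have de : `|d| <= e.
    rewrite -(ler_pXn2r (ltn0Sn 1)) ?nnegrE ?(ltW e0)//.
    rewrite -normrX ger0_norm ?sqr_ge0//.
    by rewrite (le_trans _ re)// lerDl sqr_ge0.
  have h1 : - (`|n| * e) <= n * d.
    rewrite lerNl (le_trans (ler_norm _))// normrN normrM ler_wpM2l//.
  have h2 : - (`|a| * e) <= a * r.
    rewrite lerNl (le_trans (ler_norm _))// normrN normrM ler_wpM2l//.
    by rewrite ger0_norm// (le_trans re)// expr2 ler_piMl// ltW.
  lra.
Qed.

(** For [a = 0] the geodesic is a vertical half-line ending at infinity, which
is then not in the ideal boundary. *)
Lemma ideal_boundary_half_space_infty (R : realType) (a b c : R) :
  geodesic_coeffs a b c ->
  ideal_boundary (half_space a b c) None <-> 0 < a.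
Proof.
rewrite /geodesic_coeffs half_spaceE => disc; split=> [[M MH]|a0].
- rewrite ltNge; apply/negP => a_le0.
  have b2 := sqr_ge0 b.
  have d0 : 0 < b ^+ 2 - a.
    move: a_le0; rewrite le_eqVlt => /predU1P[a0|a0]; last by lra.
    by move: disc; rewrite a0 mulr0 mul0r; lra.
  (* a = 0 forces b <> 0: go to infinity in the direction - b + i *)
  pose T := 1 + `|M| + `|c| / (b ^+ 2 - a).
  have M0 := normr_ge0 M.
  have c0 : 0 <= `|c| / (b ^+ 2 - a) by rewrite divr_ge0// ltW.
  have T1 : 1 <= T by rewrite /T; lra.
  have T0 : 0 < T by lra.
  have MT : M < normc ((- (b * T)) +i* T).
    apply: (@lt_le_trans _ _ T).
      by rewrite (le_lt_trans (ler_norm M))// /T; lra.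
    rewrite -(ler_pXn2r (ltn0Sn 1)) ?nnegrE ?normc_ge0 ?(ltW T0)// normc_sqr /=.
    by rewrite lerDr sqr_ge0.
  have [_ /=] := MH ((- (b * T)) +i* T) T0 MT.
  apply/negP; rewrite -leNgt /circle_form /=.
  have cT : `|c| <= (b ^+ 2 - a) * T.
    by rewrite mulrC -ler_pdivrMr// /T; lra.
  have cc := ler_norm c.
  have -> : a * ((- (b * T)) ^+ 2 + T ^+ 2) + b * (- (b * T)) + 0 * T + c =
    a * (T ^+ 2 * b ^+ 2) + (a * T) * (T - 1) - (b ^+ 2 - a) * T + c by ring.
  have h1 : a * (T ^+ 2 * b ^+ 2) <= 0.
    by rewrite mulr_le0_ge0// mulr_ge0// sqr_ge0.
  have h2 : (a * T) * (T - 1) <= 0.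
    by rewrite mulr_le0_ge0 ?subr_ge0// mulr_le0_ge0// ltW.
  lra.
- exists (1 + (`|b| + `|c|) / a) => z z0 Mz; split => //=.
  rewrite /circle_form mul0r addr0 -normc_sqr.
  set r := normc z in Mz *.
  have bc0 : 0 <= (`|b| + `|c|) / a by rewrite divr_ge0 ?addr_ge0// ltW.
  have r1 : 1 < r by lra.
  have r0 : 0 < r by lra.
  have ar : `|b| + `|c| < a * r by rewrite mulrC -ltr_pdivrMr//; lra.
  have xr : `|complex.Re z| <= r.
    rewrite -(ler_pXn2r (ltn0Sn 1)) ?nnegrE ?(ltW r0)//.
    rewrite -normrX ger0_norm ?sqr_ge0//.
    by rewrite /r normc_sqr lerDl sqr_ge0.
  have h1 : - (`|b| * r) <= b * complex.Re z.
    by rewrite lerNl (le_trans (ler_norm _))// normrN normrM ler_wpM2l.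
  have h2 : - (`|c| * r) <= c.
    rewrite lerNl (le_trans (ler_norm _))// normrN -[X in X <= _]mulr1.
    by rewrite ler_wpM2l// ltW.
  have h3 : (`|b| + `|c|) * r < a * r ^+ 2 by rewrite expr2 mulrA ltr_pM2r.
  lra.
Qed.

(** * The inequality *)

(** The normalized numerator and denominator of a slope differ from any other
reduced pair by a common sign. *)
Lemma slope_num_den_mk_slope (p q : int) : coprimez p q ->
  exists2 e : int, e ^+ 2 = 1 &
    slope_num (mk_slope p q) = e * p /\ slope_den (mk_slope p q) = e * q.
Proof.
rewrite /mk_slope; have [->|q0] := eqVneq q 0.
  rewrite /coprimez gcdz0 => /eqP p1.
  have pp : p * p = 1.
    by rewrite -expr2 -real_normK ?num_real// -abszE p1 expr1n.
  by exists p; rewrite ?expr2// mulr0 pp.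
move=> pq; exists (Num.sg q); first by rewrite sqr_sg q0.
rewrite /slope_num /slope_den coprimeq_num// coprimeq_den//.
by rewrite (negPf q0) normrEsg.
Qed.

Lemma slope_det_neq0 (R : realType) (s s' : slope) : s' <> s ->
  ((slope_num s)%:~R * (slope_den s')%:~R
    - (slope_num s')%:~R * (slope_den s)%:~R : R) != 0.
Proof.
move=> ss'; rewrite -!intrM -intrB intr_eq0 subr_eq0.
apply/eqP => E; apply: ss'; case: s s' E => [r|] [r'|] //=.
- move=> E; congr Some; rewrite -[r']divq_num_den -[r]divq_num_den.
  apply/eqP; rewrite eqr_div ?intr_eq0 ?denq_eq0// -!intrM eqr_int.
  by rewrite E.
- by move/eqP; rewrite mulr0 mul1r eq_sym denq_eq0.
- by move/eqP; rewrite mulr0 mul1r denq_eq0.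
Qed.

Lemma inequality_interval_unit (R : realType) (p q p' q' e e' : int) (rho : R) :
  e ^+ 2 = 1 -> e' ^+ 2 = 1 ->
  inequality_interval (e * p) (e * q) (e' * p') (e' * q') rho =
    inequality_interval p q p' q' rho.
Proof.
move=> e1 e'1.
have normM (d : int) (t : R) : d ^+ 2 = 1 -> `|d%:~R * t| ^+ 2 = `|t| ^+ 2.
  by move=> d1; rewrite -!normrX exprMn -rmorphXn/= d1 mul1r.
apply/seteqP; split=> -[x|]; rewrite /inequality_interval /= !intrM.
- by rewrite -!mulrA -!mulrDr !normM.
- by rewrite !normM.
- by rewrite -!mulrA -!mulrDr !normM.
- by rewrite !normM.
Qed.

Lemma inequality_interval_excluded (R : realType) (s s' : slope) (rho : R) :
  s' <> s -> 0 < rho ->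
  inequality_interval (slope_num s) (slope_den s)
    (slope_num s') (slope_den s') rho = excluded_interval s s' rho.
Proof.
move=> /(slope_det_neq0 R) D0 rho0.
rewrite /excluded_interval excluded_half_spaceE//.
have disc := bisector_coeffs rho0 D0.
have sqr_norm (t : R) : `|t| ^+ 2 = t ^+ 2.
  by rewrite -normrX ger0_norm// sqr_ge0.
apply/seteqP; split=> -[x|]; rewrite /inequality_interval /= !sqr_norm.
- move=> H; apply/(ideal_boundary_half_space_real _ disc).
  by move: H; rewrite -subr_gt0; congr (0 < _); ring.
- by move=> H; apply/(ideal_boundary_half_space_infty disc); rewrite subr_gt0.
- move/(ideal_boundary_half_space_real _ disc) => H.
  by rewrite -subr_gt0; move: H; congr (0 < _); ring.
- by move/(ideal_boundary_half_space_infty disc); rewrite subr_gt0.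
Qed.

Theorem theorem8p4 (R : realType) (f : sphere R -> sphere R)
    (h : pillowcase R -> sphere R) (p q p' q' : int) (rho : R) :
  thurston_map f ->
  (postcritical f #= `I_4)%card ->
  marking (postcritical f) h ->
  coprimez p q ->
  coprimez p' q' ->
  slope_function f h (mk_slope p q) (Some (mk_slope p' q')) ->
  multiplier f h (mk_slope p q) rho ->
  mk_slope p' q' <> mk_slope p q ->
  inequality_interval p q p' q' rho =
    excluded_interval (mk_slope p q) (mk_slope p' q') rho.
Proof.
move=> _ _ _ pq p'q' _ /multiplier_gt0 rho0 neq.
have [e e1 [numE denE]] := slope_num_den_mk_slope pq.
have [e' e'1 [numE' denE']] := slope_num_den_mk_slope p'q'.
rewrite -inequality_interval_excluded// numE denE numE' denE'.
by rewrite inequality_interval_unit.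
Qed.
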